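(* Let $\tilde a\in L^1_{\mathrm{loc}}(\mathbb{R}_+)$ and assume $\tilde a(t)>0$ for all $t\ge0$. Let $w^{(N)}_i>0$, $i=1,\dots,N$, $N=1,2,\dots$, be positive constants, and let the intensity measures be $\rho^{(N)}_i((s,t])=w^{(N)}_i\int_s^t\tilde a(u)\,du$. Put $Z(N)=\sum_{i=1}^N w^{(N)}_i$ and assume $\lim_{N\to\infty}Z(N)=\infty$. If there exists a probability distribution $\lambda$ on $\mathbb{R}_+$ such that $$\lambda^{(N)}:=\frac1N\sum_{i=1}^N\delta_{w^{(N)}_i}\to\lambda\quad\text{weakly as }N\to\infty,$$ then for each $t\ge0$ $$Y^{(N)}_C\big(s^{(N)}(Z(N)\,t)\big)\ \to\ y_C(A^{-1}(t))=1-\int_{\mathbb{R}_+}e^{-w t}\,\lambda(dw)\quad\text{in probability, as }N\to\infty,$$ where $y_C(t)=1-\int_{\mathbb{R}_+}e^{-wA(t)}\,\lambda(dw)$.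
   Context: $\mathbb{R}_+=[0,\infty)$; $L^1_{\mathrm{loc}}(\mathbb{R}_+)$ is the space of locally integrable functions on $\mathbb{R}_+$; $\delta_c$ is the unit point mass at $c$. For each positive integer $N$, $\nu^{(N)}_1,\dots,\nu^{(N)}_N$ are independent Poisson random measures on $\mathbb{R}_+$, defined on a probability space $(\Omega,\mathcal F,\mathrm P)$, with intensity measures $\rho^{(N)}_i$ (so $\mathrm E[\nu^{(N)}_i(B)]=\rho^{(N)}_i(B)$). As part of the setting, with probability $1$, $\nu^{(N)}_i=\sum_{j=1}^\infty\delta_{\tau^{(N)}_{i,j}}$ with $0<\tau^{(N)}_{i,1}<\tau^{(N)}_{i,2}<\cdots$, and $\tau^{(N)}_{i,j}\neq\tau^{(N)}_{i',j'}$ if $(i,j)\ne(i',j')$; in particular each $\nu^{(N)}_i$ has infinitely many atoms, i.e. $\int_0^\infty\tilde a(u)\,du=\infty$. Notation: $Y^{(N)}_C(t)=\frac1N\sum_{i=1}^N\mathbf 1_{\{\tau^{(N)}_{i,1}\le t\}}$; $A(t)=\int_0^t\tilde a(u)\,du$, a strictly increasing continuous function with continuous inverse $A^{-1}$; $S^{(N)}(t)=\sum_{i=1}^N\nu^{(N)}_i((0,t])$; and $s^{(N)}(t)=\inf\{s\ge0:\ S^{(N)}(s)>t\}$ is the right continuous inverse of $S^{(N)}$. *)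

(* Defs.v *)
From HB Require Import structures.
From mathcomp Require Import all_boot all_order all_algebra.
From mathcomp Require Import all_classical all_reals all_analysis.
From mathcomp Require Import measurable_realfun.
Set Implicit Arguments.
Unset Strict Implicit.
Unset Printing Implicit Defensive.
Import Order.TTheory GRing.Theory Num.Theory.
Import numFieldNormedType.Exports.
Local Open Scope classical_set_scope.
Local Open Scope ring_scope.

Definition Rplus (R : realType) : set R := `[0, +oo[%classic.
Arguments Rplus R : clear implicits.

(* The library predicate [locally_integrable] requires an open domain, which
   [0, oo[ is not. *)
Definition L1loc_Rplus (R : realType) (a : R -> R) : Prop :=
  forall K : set R, compact K -> K `<=` Rplus R ->
    (@lebesgue_measure R).-integrable K (EFin \o a).

Section independence.
Context {d : measure_display} {T : measurableType d} {R : realType}.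
Variable P : probability T R.

Definition independent_systems (I : finType) (F : I -> set (set T)) : Prop :=
  forall (J : {set I}) (E : I -> set T),
    (forall i, i \in J -> F i (E i)) ->
    P (\bigcap_(i in [set` J]) E i) = (\prod_(i in J) P (E i))%E.

(* A random measure on R_+ is represented by a kernel from the probability
   space to R of which only the values on subsets of R_+ are ever considered. *)
Definition sigma_of_random_measure (nu : R.-ker T ~> R) : set (set T) :=
  <<s \bigcup_(B in [set B | measurable B /\ B `<=` Rplus R])
        g_sigma_algebra_preimage (nu ^~ B) >>.

(* [poisson_prob 0] is the point mass at 0 (whereas [poisson_pmf 0] is
   constantly 1), so the first item also covers null sets of [rho]. Its second
   argument (here 0) is a dummy that its definition ignores. *)
Definition poisson_random_measure (rho : {measure set R -> \bar R})
    (nu : R.-ker T ~> R) : Prop :=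
  [/\ (forall B, measurable B -> B `<=` Rplus R -> (rho B < +oo)%E ->
         forall k : nat,
           P [set x | nu x B = k%:R%:E] = poisson_prob (fine (rho B)) 0 [set k]),
      (forall B, measurable B -> B `<=` Rplus R -> rho B = +oo%E ->
         P [set x | nu x B = +oo%E] = 1%E) &
      (forall (n : nat) (B : 'I_n -> set R),
         (forall i, measurable (B i) /\ B i `<=` Rplus R) ->
         trivIset setT B ->
         independent_systems (fun i => g_sigma_algebra_preimage (nu ^~ (B i))))].

Definition cvg_in_probability (X : nat -> T -> R) (l : R) : Prop :=
  forall e : R, 0 < e ->
    P [set x | e < `|X N x - l|] @[N --> \oo] --> 0%E.

End independence.

Section empirical_measure.
Context {R : realType} (N : nat) (w : 'I_N -> R).

Definition empirical_measure (B : set R) : \bar R :=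
  ((N%:R^-1 : R)%:E * \sum_(i < N) \d_(w i) B)%E.

Let empirical_measure0 : empirical_measure set0 = 0%E.
Proof. by rewrite /empirical_measure big1 ?mule0// => i _; rewrite measure0. Qed.

Let empirical_measure_ge0 B : (0 <= empirical_measure B)%E.
Proof.
by rewrite mule_ge0 ?lee_fin ?invr_ge0//; apply: sume_ge0 => i _.
Qed.

Let empirical_measure_sigma_additive : semi_sigma_additive empirical_measure.
Proof.
move=> F mF tF mUF.
rewrite [X in _ --> X](_ : _ =
  (\sum_(0 <= k <oo) empirical_measure (F k))%E); last first.
  rewrite /empirical_measure nneseriesZl//; last first.
    by move=> k _; apply: sume_ge0.
  congr (_ * _)%E; rewrite nneseries_sum//; apply: eq_bigr => i _.
  exact: measure_semi_bigcup.
by apply: is_cvg_nneseries => k _ _; exact: empirical_measure_ge0.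
Qed.

HB.instance Definition _ := isMeasure.Build _ _ _ empirical_measure
  empirical_measure0 empirical_measure_ge0 empirical_measure_sigma_additive.

End empirical_measure.

Definition weakly_cvg_Rplus (R : realType)
    (mu_ : nat -> {measure set R -> \bar R})
    (mu : {measure set R -> \bar R}) : Prop :=
  forall f : R -> R, {within Rplus R, continuous f} ->
    (exists M : R, forall x, Rplus R x -> `|f x| <= M) ->
    \int[mu_ N]_(x in Rplus R) f x @[N --> \oo] --> \int[mu]_(x in Rplus R) f x.

Section coupon_collector.
Context {d : measure_display} {T : measurableType d} {R : realType}.
Variable P : probability T R.

(* tau i j is the time of the (j+1)-st atom of the i-th random measure. *)
Definition Y_C (N : nat) (tau : 'I_N -> nat -> {RV P >-> R}) (t : R) (x : T) : R :=
  N%:R^-1 * \sum_(i < N) (\1_[set y | tau i 0%N y <= t] x).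

Definition S_total (N : nat) (nu : 'I_N -> R.-ker T ~> R) (t : R) (x : T) :
    \bar R :=
  (\sum_(i < N) nu i x `]0%R, t]%classic)%E.

(* On the null event where the set below is empty, [inf] returns 0. *)
Definition s_inv (N : nat) (nu : 'I_N -> R.-ker T ~> R) (t : R) (x : T) : R :=
  inf [set s | 0 <= s /\ (t%:E < S_total nu s x)%E].

(* nu = sum_j delta_(tau j) on R_+, with increasing atoms that are not shared
   by different indices i. *)
Definition atomic_decomposition (N : nat) (nu : 'I_N -> R.-ker T ~> R)
    (tau : 'I_N -> nat -> {RV P >-> R}) : Prop :=
  {ae P, forall x,
    [/\ (forall i B, measurable B -> B `<=` Rplus R ->
           nu i x B = (\sum_(0 <= j <oo) \d_(tau i j x) B)%E),
        (forall i, 0 < tau i 0%N x),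
        (forall i j, tau i j x < tau i j.+1 x) &
        (forall i j i' j', (i, j) <> (i', j') -> tau i j x <> tau i' j' x)]}.

Definition A_int (a : R -> R) (t : R) : R :=
  \int[lebesgue_measure]_(u in `[0, t]) a u.

Definition A_inv (a : R -> R) : R -> R := 'pinv_(fun=> 0) (Rplus R) (A_int a).

Definition y_C (a : R -> R) (lambda : {measure set R -> \bar R}) (t : R) : R :=
  1 - \int[lambda]_(w in Rplus R) expR (- (w * A_int a t)).

End coupon_collector.

(* Main.v *)
(* Measure time by v = A(u): in the window ]0, A^{-1}(v)] the N counts are
   independent Poisson variables with means w_i v. By Chebyshev the total count
   is Z(N) v + o(Z(N)), so s(Z(N) t) eventually lies between A^{-1}(t - h) and
   A^{-1}(t + h) off an event of small probability. Coupon i has been collected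
   by time A^{-1}(v) iff its count is nonzero, so again by Chebyshev the
   collected fraction there is close to its mean
   1 - (1/N) sum_i exp(- w_i v), which tends to 1 - int exp(- w v) lambda(dw) by
   weak convergence. The collected fraction is monotone in time and this limit
   is continuous in v, so letting h tend to 0 squeezes the value at s(Z(N) t).
   At t = 0 only the upper half of the squeeze is needed. *)
Require Import Defs.
From mathcomp Require Import all_boot all_order all_algebra.
From mathcomp Require Import all_classical all_reals all_analysis.
From mathcomp Require Import ring lra.
From mathcomp Require Import measurable_realfun.
Import Order.TTheory GRing.Theory Num.Theory.
Import numFieldNormedType.Exports.
Local Open Scope classical_set_scope.
Local Open Scope ring_scope.

Set Implicit Arguments.
Unset Strict Implicit.
Unset Printing Implicit Defensive.

(** * Independence, covariance and the variance of finite sums *)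

Section uncorrelated_sums.
Local Open Scope ereal_scope.
Context d (T : measurableType d) (R : realType) (P : probability T R).

Definition independent_pair (X Y : T -> R) : Prop :=
  forall A B : set R, measurable A -> measurable B ->
    P (X @^-1` A `&` Y @^-1` B) = P (X @^-1` A) * P (Y @^-1` B).

(** Independence makes the joint law of the pair agree with the product of the two laws on
    rectangles, hence everywhere; Tonelli then factors the integral. *)
Lemma expectationM_indep (X Y : {mfun T >-> R}) :
  (forall x, 0 <= X x)%R -> (forall x, 0 <= Y x)%R -> independent_pair X Y ->
  'E_P[X * Y] = 'E_P[X] * 'E_P[Y].
Proof.
move=> X0 Y0 XY.
have mX : measurable_fun setT X by [].
have mY : measurable_fun setT Y by [].
have mXY : measurable_fun setT (fun x => (X x, Y x)).
  exact: measurable_fun_pair.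
have mabs : measurable_fun setT (fun y : R => `|y|%:E).
  by apply/measurable_EFinP; exact: normr_measurable.
(* The absolute values make the integrand nonnegative on the whole plane, as Tonelli requires, and
   do not change it along [(X x, Y x)]. *)
pose f (z : R * R) := `|z.1|%:E * `|z.2|%:E.
have mf : measurable_fun setT f.
  by apply: emeasurable_funM; apply/measurable_EFinP; exact: measurableT_comp.
have f0 z : 0 <= f z by rewrite mule_ge0.
rewrite !unlock.
transitivity (\int[P]_x f (X x, Y x)).
  by apply: eq_integral => x _; rewrite /f /= !ger0_norm.
rewrite -[LHS](@ge0_integral_pushforward _ _ _ _ R _ mXY P setT f)//.
rewrite (eq_measure_integral (distribution P X \x distribution P Y)); last first.
  move=> A mA _; apply/esym; apply: product_measure_unique mA => C D mC mD.
  exact: XY.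
rewrite fubini_tonelli1// /fubini_F.
have E (Z : {mfun T >-> R}) : (forall x, 0 <= Z x)%R ->
    \int[distribution P Z]_y `|y|%:E = \int[P]_x (Z x)%:E.
  move=> Z0; rewrite ge0_integral_pushforward//.
  by apply: eq_integral => x _ /=; rewrite ger0_norm.
under eq_integral do rewrite /f /= ge0_integralZl// E//.
by rewrite ge0_integralZr ?integral_ge0// ?E// => x _; rewrite lee_fin.
Qed.

Lemma integrable_sqr_Lfun2 (f : T -> R) : measurable_fun setT f ->
  \int[P]_x ((f x) ^+ 2)%:E < +oo -> f \in Lfun P 2%:E.
Proof.
move=> mf f2; rewrite inE; apply/andP; split; rewrite inE//=.
rewrite /finite_norm unlock poweR_lty//.
rewrite (eq_integral (fun x => ((f x) ^+ 2)%:E))// => x _ /=.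
by rewrite powR_mulrn// real_normK ?num_real.
Qed.

Lemma covariance_indep (X Y : {mfun T >-> R}) :
  (forall x, 0 <= X x)%R -> (forall x, 0 <= Y x)%R ->
  (X : T -> R) \in Lfun P 2%:E -> (Y : T -> R) \in Lfun P 2%:E ->
  independent_pair X Y -> covariance P X Y = 0.
Proof.
move=> X0 Y0 X2 Y2 XY.
have Pfin : P setT \is a fin_num := fin_num_measure P _ measurableT.
have X1 := Lfun_subset12 Pfin X2.
have Y1 := Lfun_subset12 Pfin Y2.
have XY1 := Lfun2_mul_Lfun1 X2 Y2.
by rewrite covarianceE// expectationM_indep// subee// fin_numM//
  expectation_fin_num.
Qed.

Variables (I : eqType) (f : I -> T -> R).
Hypothesis f2 : forall i, f i \in Lfun P 2%:E.

Lemma Lfun_sum (s : seq I) : (fun x => \sum_(i <- s) f i x)%R \in Lfun P 2%:E.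
Proof.
rewrite [X in X \in _](_ : _ = (\sum_(i <- s) f i)%R); last first.
  by apply/funext => x; rewrite fct_sumE.
by rewrite rpred_sum ?lee1n// => i _; rewrite f2.
Qed.

Lemma sum_fun_cons (i : I) s : (fun x => \sum_(j <- i :: s) f j x)%R =
  (f i \+ (fun x => \sum_(j <- s) f j x))%R.
Proof. by apply/funext => x; rewrite big_cons. Qed.

Lemma expectation_sum_fun (s : seq I) :
  'E_P[(fun x => \sum_(i <- s) f i x)%R] = \sum_(i <- s) 'E_P[f i].
Proof.
have Pfin : P setT \is a fin_num := fin_num_measure P _ measurableT.
elim: s => [|i s IH].
  rewrite big_nil -[RHS](expectation_cst P 0); congr expectation.
  by apply/funext => x; rewrite big_nil.
rewrite sum_fun_cons expectationD ?IH ?big_cons//; apply: Lfun_subset12 => //.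
exact: Lfun_sum.
Qed.

(** By bilinearity each term is uncorrelated with the sum of the later ones, so no cross term
    survives; [uniq] keeps a term from being paired with itself. *)
Lemma variance_sum (s : seq I) : uniq s ->
  (forall i j, i != j -> covariance P (f i) (f j) = 0) ->
  'V_P[(fun x => \sum_(i <- s) f i x)%R] = \sum_(i <- s) 'V_P[f i].
Proof.
move=> us f0.
have cov i r : i \notin r ->
    covariance P (f i) (fun x => \sum_(j <- r) f j x)%R = 0.
  elim: r => [_|j r IH].
    rewrite -[RHS](covariance_cst_r P (f i) 0%R); congr covariance.
    by apply/funext => x; rewrite big_nil.
  rewrite inE negb_or => /andP[ij ir].
  by rewrite sum_fun_cons covarianceDr ?Lfun_sum// IH// f0// adde0.
elim: s us => [_|i s IH /= /andP[si us]].
  rewrite big_nil -[RHS](variance_cst P 0); congr variance.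
  by apply/funext => x; rewrite big_nil.
rewrite sum_fun_cons varianceD ?Lfun_sum// cov// mule0 adde0.
by rewrite IH// big_cons.
Qed.

End uncorrelated_sums.

(** * Chebyshev's inequality for pairwise independent sums *)

Section weak_law.
Local Open Scope ereal_scope.
Context d (T : measurableType d) (R : realType) (P : probability T R).

(** The variances enter only through upper bounds [v], so that one statement serves both Poisson
    counts, with variance equal to the mean, and indicators, with variance at most 1. *)
Lemma chebyshev_sum (I : finType) (f : I -> {mfun T >-> R}) (m : R) (v : I -> R)
    (e : R) :
  (forall i x, 0 <= f i x)%R ->
  (forall i, (f i : T -> R) \in Lfun P 2%:E) ->
  (forall i j, i != j -> independent_pair P (f i) (f j)) ->
  \sum_i 'E_P[f i] = m%:E ->
  (forall i, 'V_P[f i] <= (v i)%:E) ->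
  (0 < e)%R ->
  P [set x | (e <= `|\sum_i f i x - m|)%R] <= (e ^- 2 * \sum_i v i)%:E.
Proof.
move=> f0 f2 find fm fv e0.
have S2 : (fun x => \sum_i f i x)%R \in Lfun P 2%:E by exact: Lfun_sum.
have mS : measurable_fun setT (fun x => \sum_i f i x)%R.
  exact: measurable_sum.
pose S : {mfun T >-> R} := mfun_Sub (mem_set mS).
have SE : S = (fun x => \sum_i f i x)%R :> (T -> R) by [].
have := @chebyshev _ _ _ P S e e0.
rewrite SE expectation_sum_fun// fm => /le_trans; apply.
rewrite variance_sum ?index_enum_uniq//; last first.
  by move=> i j ij; apply: covariance_indep => //; exact: find.
rewrite EFinM lee_wpmul2l ?lee_fin ?invr_ge0 ?exprn_ge0 ?(ltW e0)//.
by rewrite -sumEFin lee_sum.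
Qed.

End weak_law.

(** * Moments of an extended-real variable with Poisson masses *)

Section poisson_moments.
Local Open Scope ereal_scope.
Context d (T : measurableType d) (R : realType) (P : probability T R).

Lemma poisson_prob1 (m : R) k : (0 < m)%R ->
  poisson_prob m 0 [set k] = (poisson_pmf m k)%:E.
Proof.
by move=> m0; rewrite /poisson_prob m0 esum_set1// lee_fin poisson_pmf_ge0.
Qed.

Lemma sum_poisson_pmf (m : R) : (0 < m)%R ->
  \sum_(k <oo) (poisson_pmf m k)%:E = 1.
Proof.
move=> m0.
have : poisson_prob m 0 setT = 1 by exact: probability_setT.
rewrite /poisson_prob m0 => <-; rewrite nneseries_esumT// => k.
by rewrite lee_fin poisson_pmf_ge0.
Qed.

(** Rests on [(k+1) * pmf (k+1) = m * pmf k], after dropping the zero term at [k = 0]. Each use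
    lowers the degree of a moment by one. *)
Lemma sum_poisson_pmf_shift (m : R) (g : nat -> R) : (0 < m)%R ->
  (forall k, 0 <= g k)%R -> g 0%N = 0%R ->
  \sum_(k <oo) (g k * poisson_pmf m k)%:E =
  \sum_(k <oo) (m * (g k.+1 / k.+1%:R * poisson_pmf m k))%:E.
Proof.
move=> m0 g0 g00; rewrite nneseries_recl//; last first.
  by move=> k _; rewrite lee_fin mulr_ge0 ?poisson_pmf_ge0.
rewrite g00 mul0r add0e -nneseries_addn; last first.
  by move=> k; rewrite lee_fin mulr_ge0 ?poisson_pmf_ge0.
apply: eq_eseriesr => k _; congr EFin; rewrite addn1 /poisson_pmf m0.
rewrite factS natrM exprS invfM.
ring.
Qed.

Lemma sum_poisson_pmf_mean (m : R) : (0 < m)%R ->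
  \sum_(k <oo) (k%:R * poisson_pmf m k)%:E = m%:E.
Proof.
move=> m0; rewrite (sum_poisson_pmf_shift (g := fun k => k%:R))//.
under eq_eseriesr do rewrite divff// mul1r EFinM.
rewrite nneseriesZl ?sum_poisson_pmf ?mule1// => k _.
by rewrite lee_fin poisson_pmf_ge0.
Qed.

Lemma sum_poisson_pmf_sqr (m : R) : (0 < m)%R ->
  \sum_(k <oo) (k%:R ^+ 2 * poisson_pmf m k)%:E = (m ^+ 2 + m)%:E.
Proof.
move=> m0.
rewrite (sum_poisson_pmf_shift (g := fun k => k%:R ^+ 2)%R)// ?expr0n//.
(* The shifted weight is [k + 1], so the sum becomes [m] times the mean plus the total mass. *)
under eq_eseriesr => k _.
  rewrite expr2 mulfK// -natr1 mulrDl mul1r EFinM EFinD; over.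
have p0 k : (0 <= k)%N -> xpredT k -> 0 <= (poisson_pmf m k)%:E.
  by rewrite lee_fin poisson_pmf_ge0.
have q0 k : (0 <= k)%N -> xpredT k -> 0 <= (k%:R * poisson_pmf m k)%:E.
  by rewrite lee_fin mulr_ge0 ?poisson_pmf_ge0.
rewrite nneseriesZl; last by move=> k _; rewrite adde_ge0 ?p0 ?q0.
rewrite nneseriesD// sum_poisson_pmf_mean// sum_poisson_pmf//.
by rewrite -EFinD -EFinM mulrDr mulr1.
Qed.

Variables (X : T -> \bar R) (m : R).
Hypothesis mX : measurable_fun setT X.
Hypothesis m0 : (0 < m)%R.
Hypothesis Xm : forall k : nat,
  P [set x | X x = k%:R%:E] = poisson_prob m 0 [set k].

Let E (k : nat) : set T := [set x | X x = k%:R%:E].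

Let mE k : measurable (E k).
Proof. by rewrite -[E k]setTI; exact: (mX measurableT (emeasurable_set1 _)). Qed.

Let tE : trivIset setT E.
Proof.
move=> i j _ _ [x []]; rewrite /E /= => -> [] /eqP.
by rewrite eqr_nat => /eqP.
Qed.

Let PEk k : P (E k) = (poisson_pmf m k)%:E.
Proof. by rewrite -poisson_prob1// -Xm. Qed.

Let PE : P (\bigcup_k E k) = 1.
Proof.
rewrite measure_semi_bigcup//; last exact: bigcup_measurable.
rewrite -(sum_poisson_pmf m0).
by apply: eq_eseriesr => k _; exact: PEk.
Qed.

Let PEC : P (~` \bigcup_k E k) = 0.
Proof.
by rewrite probability_setC ?PE ?subee//; exact: bigcup_measurable.
Qed.

(** The Poisson masses already sum to 1, which leaves nothing for [+oo] or for non-integers. *)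
Lemma poisson_ae_nat : {ae P, forall x, exists k : nat, X x = k%:R%:E}.
Proof.
exists (~` \bigcup_k E k); split => //.
  by apply: measurableC; exact: bigcup_measurable.
by apply: subsetC => x [k _ Xk]; exists k.
Qed.

(** Up to a null set the space splits into the level sets of the naturals, and the integrand is
    constant on each. On the null set [fine] may return its default. *)
Lemma poisson_integral (g : R -> R) : measurable_fun setT g ->
  (forall y, 0 <= g y)%R ->
  \int[P]_x (g (fine (X x)))%:E = \sum_(k <oo) (g k%:R * poisson_pmf m k)%:E.
Proof.
move=> mg g0.
have mgX : measurable_fun setT (fun x => (g (fine (X x)))%:E).
  apply/measurable_EFinP; apply: measurableT_comp => //.
  exact: measurableT_comp.
rewrite (@ge0_negligible_integral _ _ _ _ _ (~` \bigcup_k E k))//; last first.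
- by move=> x _; rewrite lee_fin.
- by apply: measurableC; exact: bigcup_measurable.
rewrite setTD setCK ge0_integral_bigcup//; last 2 first.
- exact: measurable_funTS.
- by move=> x _; rewrite lee_fin.
apply: eq_eseriesr => k _.
rewrite (eq_integral (cst (g k%:R)%:E)); last first.
  by move=> x /set_mem -> /=.
by rewrite integral_cst// EFinM; congr (_ * _); exact: PEk.
Qed.

End poisson_moments.

Lemma RplusE (R : realType) (x : R) : Rplus R x = (0 <= x) :> Prop.
Proof. by rewrite /Rplus /= in_itv/= andbT. Qed.

(** * The clock A and its right inverse *)

Section time_change.
Context (R : realType) (a : R -> R).
Hypothesis a_loc : L1loc_Rplus a.
Hypothesis a_ge0 : forall t : R, 0 <= t -> 0 <= a t.
Hypothesis a_infty :
  (\int[lebesgue_measure]_(u in Rplus R) (a u)%:E = +oo)%E.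

Let mu := @lebesgue_measure R.

Let a_int (u : R) : mu.-integrable `[0, u] (EFin \o a).
Proof.
apply: a_loc; first exact: segment_compact.
by move=> x /=; rewrite RplusE in_itv/= => /andP[].
Qed.

Lemma A_intE (u : R) : (\int[mu]_(x in `[0%R, u]) (a x)%:E = (A_int a u)%:E)%E.
Proof. by rewrite /A_int /Rintegral fineK// integrable_fin_num. Qed.

Lemma A_int_oc (u : R) : 0 <= u ->
  (\int[mu]_(x in `]0%R, u]) (a x)%:E = (A_int a u)%:E)%E.
Proof.
move=> u0; rewrite -A_intE integral_itv_obnd_cbnd//.
apply: measurable_funS (measurable_int _ (a_int u)) => //.
exact: subset_itv_oc_cc.
Qed.

Lemma A_int0 : A_int a 0 = 0.
Proof. by rewrite /A_int set_itv1 Rintegral_set1. Qed.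

(** If A stayed below [v], monotone convergence along the intervals from 0 to [n] would bound the
    integral over all of R_+ by [v]. *)
Lemma A_int_unbounded (v : R) : exists2 u : R, 0 <= u & v <= A_int a u.
Proof.
apply: contrapT => /forall2NP h.
have Av n : (\int[mu]_(x in `[0%R, n%:R]) (a x)%:E <= v%:E)%E.
  by rewrite A_intE lee_fin; case: (h n%:R) => [/negP//|/negP]; rewrite -ltNge => /ltW.
pose F (n : nat) : set R := `[0, n%:R]%classic.
have UE : \bigcup_n F n = Rplus R.
  apply/seteqP; split => x; rewrite RplusE.
    by move=> [n _]; rewrite /F /= in_itv/= => /andP[].
  move=> x0; exists (Num.truncn x).+1 => //.
  by rewrite /F /= in_itv/= x0/= ltW// truncnS_gt.
have : (\int[mu]_(x in F n) (a x)%:E @[n --> \oo] -->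
    \int[mu]_(x in \bigcup_n F n) (a x)%:E)%E.
  apply: ge0_nondecreasing_set_cvg_integral.
  - move=> m n mn; apply/subsetPset => x; rewrite /F /= !in_itv/= => /andP[-> xm]/=.
    by rewrite (le_trans xm)// ler_nat.
  - by move=> n; exact: measurable_itv.
  - by move=> n; exact: measurable_int (a_int n%:R).
  - by move=> n x; rewrite /F /= in_itv/= => /andP[x0 _]; rewrite lee_fin a_ge0.
rewrite UE a_infty => cF; have L := cvg_lim (@ereal_hausdorff R) cF.
have : (+oo <= v%:E)%E.
  rewrite -L; apply: lime_le; first exact: cvgP cF.
  by apply: nearW => n; exact: Av.
by rewrite leNgt ltry.
Qed.

(** Intermediate values between A(0) = 0 and a point where A has passed [v]. Surjectivity is what
    makes the partial inverse [A_inv] a right inverse of A on R_+. *)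
Lemma A_int_surj : set_surj (Rplus R) (Rplus R) (A_int a).
Proof.
move=> v; rewrite RplusE => v0.
have [u u0 vu] := A_int_unbounded v.
have /(@IVT _ (A_int a) 0 u v u0) : {within `[0, u], continuous (A_int a)}.
  exact: parameterized_integral_continuous.
rewrite A_int0 min_l ?max_r ?(le_trans v0 vu)// v0 vu => /(_ isT)[c].
rewrite in_itv/= => /andP[c0 _] <-.
by exists c => //; rewrite RplusE.
Qed.

Lemma A_invK (v : R) : 0 <= v -> A_int a (A_inv a v) = v.
Proof.
by move=> v0; rewrite /A_inv (@surjpK _ _ (fun=> 0) _ _ _ A_int_surj)// inE RplusE.
Qed.

Lemma A_inv_ge0 (v : R) : 0 <= v -> 0 <= A_inv a v.
Proof.
move=> v0; have /(_ (A_inv a v)) := @surjpinv_image_sub _ _ (fun=> 0) _ _ _ A_int_surj.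
by rewrite RplusE; apply; exists v => //; rewrite RplusE.
Qed.

End time_change.

(** * Concentration of the Poisson counts in a fixed window *)

Lemma measurable_nonzero (R : realType) :
  measurable_fun setT (fun y : \bar R => (y != 0%E)%:R : R).
Proof.
rewrite (_ : (fun _ => _) = \1_(~` [set 0%E])); last first.
  apply/funext => y; rewrite indicE; congr ((nat_of_bool _)%:R)%R.
  by apply/idP/idP => [/eqP h|]; rewrite inE// => /eqP.
by apply: measurable_indic; apply: measurableC; exact: emeasurable_set1.
Qed.

Section counts.
Local Open Scope ereal_scope.
Context d (T : measurableType d) (R : realType) (P : probability T R).
Variables (N : nat) (nu : 'I_N -> R.-ker T ~> R) (w : 'I_N -> R) (v : R) (B : set R).
Hypothesis mB : measurable B.
Hypothesis B_Rplus : B `<=` Rplus R.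
Hypothesis nu_indep :
  independent_systems P (fun i => sigma_of_random_measure (nu i)).
Hypothesis wv0 : forall i, (0 < w i * v)%R.
Hypothesis nuB : forall i (k : nat),
  P [set x | nu i x B = k%:R%:E] = poisson_prob (w i * v) 0 [set k].

Let mnu i : measurable_fun setT (fun x => nu i x B).
Proof. exact: measurable_kernel. Qed.

Lemma count_ae_fin_num : {ae P, forall x i, nu i x B \is a fin_num}.
Proof.
apply: filter_forall => i.
by apply: filterS (poisson_ae_nat (mnu i) (wv0 i) (nuB i)) => x [k ->].
Qed.

(** Each event concerns one random measure only, so it lies in the sigma-algebra of that measure;
    joint independence is applied to the index set [{i, j}]. *)
Lemma independent_pair_count (i j : 'I_N) (g : \bar R -> R) : i != j ->
  measurable_fun setT g ->
  independent_pair P (fun x => g (nu i x B)) (fun x => g (nu j x B)).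
Proof.
move=> ij mg C D mC mD.
have sigma k F : measurable F ->
    sigma_of_random_measure (nu k) ((fun x => g (nu k x B)) @^-1` F).
  move=> mF; apply: sub_sigma_algebra; exists B => //.
  exists (g @^-1` F); first by rewrite -[X in measurable X]setTI; exact: mg.
  by rewrite setTI.
pose E k := if k == i then (fun x => g (nu i x B)) @^-1` C
            else (fun x => g (nu j x B)) @^-1` D.
have := nu_indep (J := [set i; j]%SET) (E := E).
have Ej : E j = (fun x => g (nu j x B)) @^-1` D.
  by rewrite /E eq_sym (negbTE ij).
have Ei : E i = (fun x => g (nu i x B)) @^-1` C by rewrite /E eqxx.
rewrite big_setU1 ?inE//= big_set1 Ei Ej => <-; last first.
  by move=> k; rewrite !inE => /orP[]/eqP ->; rewrite ?Ei ?Ej; exact: sigma.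
congr (P _); apply/seteqP; split => x.
  move=> [xC xD] k /=; rewrite !inE => /orP[]/eqP ->; rewrite ?Ei ?Ej//.
by move=> h; split; [rewrite -Ei|rewrite -Ej]; apply: h; rewrite /= !inE eqxx ?orbT.
Qed.

Lemma total_count_concentration (e : R) : (0 < e)%R ->
  P [set x | (e <= `|\sum_i fine (nu i x B) - (\sum_i w i) * v|)%R] <=
  (e ^- 2 * ((\sum_i w i) * v))%:E.
Proof.
move=> e0.
have mf i : measurable_fun setT (fun x => fine (nu i x B)).
  exact: measurableT_comp.
pose f i : {mfun T >-> R} := mfun_Sub (mem_set (mf i)).
have f0 i x : (0 <= f i x)%R by rewrite /f/= fine_ge0.
have Ef i : 'E_P[f i] = (w i * v)%:E.
  (* [poisson_integral] wants a function that is nonnegative on all of R, hence the norm in place of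
     the identity. *)
  rewrite unlock; transitivity (\int[P]_x `|fine (nu i x B)|%:E).
    by apply: eq_integral => x _; rewrite ger0_norm// fine_ge0.
  rewrite (poisson_integral (mnu i) (wv0 i) (nuB i) (g := Num.norm))//.
  rewrite -[RHS](sum_poisson_pmf_mean (wv0 i)).
  by apply: eq_eseriesr => k _; rewrite normr_nat.
have Ef2 i : \int[P]_x (f i x ^+ 2)%:E = ((w i * v) ^+ 2 + w i * v)%:E.
  rewrite (poisson_integral (mnu i) (wv0 i) (nuB i) (g := fun x => x ^+ 2)%R).
  - exact: sum_poisson_pmf_sqr.
  - exact: measurable_funX.
  - by move=> y; exact: sqr_ge0.
have f2 i : (f i : T -> R) \in Lfun P 2%:E.
  by apply: integrable_sqr_Lfun2 => //; rewrite Ef2 ltry.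
rewrite mulr_suml.
apply: (chebyshev_sum (f := f) (v := fun i => (w i * v)%R)) => //.
- move=> i j ij; apply: (independent_pair_count (g := fine)) => //.
- by rewrite -sumEFin; apply: eq_bigr => i _; exact: Ef.
- move=> i; rewrite varianceE// Ef -EFin_expe unlock Ef2 -EFinB lee_fin.
  by rewrite addrAC subrr add0r.
Qed.

(** A Poisson count of mean [w i * v] vanishes with probability [expR (- (w i * v))], and an
    indicator has variance at most its second moment, hence at most 1. *)
Lemma nonempty_count_concentration (e : R) : (0 < e)%R ->
  P [set x | (e <= `|\sum_i (nu i x B != 0)%:R
                     - \sum_i (1 - expR (- (w i * v)))|)%R] <=
  (e ^- 2 * N%:R)%:E.
Proof.
move=> e0.
pose g (y : \bar R) : R := (y != 0)%:R%R.
have mg : measurable_fun setT g by exact: measurable_nonzero.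
have mf i : measurable_fun setT (fun x => g (nu i x B)).
  exact: measurableT_comp.
pose f i : {mfun T >-> R} := mfun_Sub (mem_set (mf i)).
have f0 i x : (0 <= f i x)%R by rewrite /f/= /g.
have f1 i x : (f i x <= 1)%R by rewrite /f/= /g; case: (_ != _).
have Ef i : 'E_P[f i] = (1 - expR (- (w i * v)))%:E.
  have mA : measurable [set x | nu i x B = 0].
    rewrite -[X in measurable X]setTI.
    exact: (mnu i measurableT (emeasurable_set1 0)).
  have -> : (f i : T -> R) = \1_(~` [set x | nu i x B = 0]).
    apply/funext => x; rewrite indicE /f/= /g; congr ((nat_of_bool _)%:R)%R.
    by apply/idP/idP => [/eqP h|]; [rewrite inE|rewrite inE => /= /eqP].
  rewrite expectation_indic; last exact: measurableC.
  rewrite probability_setC// EFinB; congr (_ - _).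
  rewrite (nuB i 0%N) poisson_prob1// /poisson_pmf wv0.
  by rewrite expr0 fact0 invr1 !mul1r.
have Ef2 i : \int[P]_x (f i x ^+ 2)%:E <= 1.
  rewrite -(probability_setT P) -[leRHS]mul1e -(integral_cst P measurableT 1).
  apply: ge0_le_integral => //.
  - by move=> x _; rewrite lee_fin sqr_ge0.
  - by apply/measurable_EFinP; exact: measurable_funX.
  - by move=> x _; rewrite lee_fin expr_le1.
have f2 i : (f i : T -> R) \in Lfun P 2%:E.
  by apply: integrable_sqr_Lfun2 => //; rewrite (le_lt_trans (Ef2 i))// ltry.
rewrite (_ : N%:R = \sum_(i < N) 1)%R; last first.
  by rewrite sumr_const card_ord.
apply: (chebyshev_sum (f := f) (v := fun=> 1%R)) => //.
- by move=> i j ij; apply: (independent_pair_count (g := g)).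
- by rewrite -sumEFin; apply: eq_bigr => i _; exact: Ef.
- move=> i; rewrite varianceE// Ef unlock (le_trans _ (Ef2 i))//.
  by rewrite leeBlDr// leeDl// -EFin_expe lee_fin sqr_ge0.
Qed.

End counts.

(** * Monotonicity and measurability of [s_inv] and [Y_C] *)

Section inverse_of_total.
Context d (T : measurableType d) (R : realType) (P : probability T R).
Variables (N : nat) (nu : 'I_N -> R.-ker T ~> R).

Lemma S_total_mono (s u : R) x : s <= u ->
  (S_total nu s x <= S_total nu u x)%E.
Proof.
move=> su; apply: lee_sum => i _; apply: le_measure; rewrite ?inE//.
by apply: subset_itvl; rewrite bnd_simp.
Qed.

Let above (t : R) x := [set s : R | 0 <= s /\ (t%:E < S_total nu s x)%E].

Let above_lb t x : has_lbound (above t x).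
Proof. by exists 0 => s []. Qed.

Lemma s_inv_le (t u : R) x : 0 <= u -> (t%:E < S_total nu u x)%E ->
  s_inv nu t x <= u.
Proof. by move=> u0 tu; apply: (ge_inf (@above_lb t x)); split. Qed.

(** The point [u'] shows that the level [t] is passed at some time; otherwise the infimum would take
    its default value 0 and the lower bound could fail. *)
Lemma s_inv_ge (t u u' : R) x : 0 <= u' -> (t%:E < S_total nu u' x)%E ->
  (S_total nu u x <= t%:E)%E -> u <= s_inv nu t x.
Proof.
move=> u'0 tu' ut; apply: lb_le_inf; first by exists u'.
move=> s [_ ts]; rewrite leNgt; apply/negP => /ltW/(S_total_mono x) su.
by have := lt_le_trans ts (le_trans su ut); rewrite ltxx.
Qed.

(** Since the total is monotone in time, rational times detect the passage of [t], which leaves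
    countable unions. The second member of the union is the case of an empty set, where the infimum
    is 0 and lies below [r] exactly when [0 < r]. *)
Lemma s_inv_ltE (t r : R) :
  [set x | s_inv nu t x < r] =
  \bigcup_(q in [set q : rat | 0 <= (ratr q : R) < r])
     [set x | (t%:E < S_total nu (ratr q) x)%E] `|`
  ([set x | 0 < r] `&` ~` \bigcup_(q in [set q : rat | 0 <= (ratr q : R)])
     [set x | (t%:E < S_total nu (ratr q) x)%E]).
Proof.
apply/seteqP; split => x /=.
  have [/inf_lt h /h[s [s0 ts] sr]|] := pselect (above t x !=set0).
    left; have [q] := rat_in_itvoo sr; rewrite in_itv/= => /andP[sq qr].
    exists q => /=; first by rewrite (le_trans s0 (ltW sq)).
    exact: lt_le_trans (S_total_mono x (ltW sq)).
  move=> E0; rewrite /s_inv (_ : [set _ | _] = set0) ?inf0; last first.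
    by apply/seteqP; split => // s hs; apply: E0; exists s.
  by move=> r0; right; split => // -[q /= q0 tq]; apply: E0; exists (ratr q).
move=> [[q /= /andP[q0 qr] tq]|[r0 nq]].
  exact: le_lt_trans (s_inv_le q0 tq) qr.
rewrite /s_inv (_ : [set _ | _] = set0) ?inf0//.
apply/seteqP; split => // s [s0 ts]; apply: nq.
have /rat_in_itvoo[q] : s < s + 1 by rewrite ltrDl.
rewrite in_itv/= => /andP[sq _]; exists q => /=.
  exact: le_trans (ltW sq).
exact: lt_le_trans (S_total_mono x (ltW sq)).
Qed.

Lemma measurable_s_inv (t : R) : measurable_fun setT (s_inv nu t).
Proof.
have mS s : measurable [set x | (t%:E < S_total nu s x)%E].
  rewrite -[X in measurable X]setTI; apply: measurable_lte => //.
  by apply: emeasurable_sum => i; exact: measurable_kernel.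
have mU (Q : set rat) : measurable (\bigcup_(q in Q)
    [set x | (t%:E < S_total nu (ratr q) x)%E]).
  rewrite bigcup_mkcond; apply: bigcupT_measurable_rat => q.
  by case: ifP.
move=> mT; apply: (measurability _ (RGenInftyO.measurableE R)) => //.
move=> _ [_ [r ->] <-]; rewrite setTI.
rewrite (_ : _ @^-1` _ = [set x | s_inv nu t x < r]); last first.
  by apply/seteqP; split => x; rewrite /= in_itv.
rewrite s_inv_ltE; apply: measurableU => //; apply: measurableI.
  have [r0|r0] := boolP (0 < r).
    by rewrite (_ : [set _ | _] = setT)//; apply/seteqP; split.
  by rewrite (_ : [set _ | _] = set0)//; apply/seteqP; split => // y /=;
    rewrite (negbTE r0).
exact: measurableC.
Qed.

Variable tau : 'I_N -> nat -> {RV P >-> R}.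

Lemma Y_C_mono (s u : R) x : s <= u -> Y_C tau s x <= Y_C tau u x.
Proof.
move=> su; rewrite /Y_C ler_wpM2l ?invr_ge0//; apply: ler_sum => i _.
rewrite !indicE ler_nat; case: (boolP (x \in _)) => //=.
rewrite inE /= => xs; rewrite mem_set//=; exact: le_trans su.
Qed.

Lemma Y_C_ge0 (s : R) x : 0 <= Y_C tau s x.
Proof. by rewrite mulr_ge0 ?invr_ge0 ?sumr_ge0. Qed.

(** The time is random, so each indicator is read as a comparison of the two measurable functions
    [tau i 0] and [s_inv nu t]. *)
Lemma measurable_Y_C_s_inv (t : R) :
  measurable_fun setT (fun x => Y_C tau (s_inv nu t x) x).
Proof.
apply: measurable_funM => //; apply: measurable_sum => i.
rewrite (_ : (fun x => _) =
    \1_[set x | tau i 0%N x <= s_inv nu t x]); last first.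
  by apply/funext => x; rewrite !indicE; congr ((nat_of_bool _)%:R);
    apply/idP/idP; rewrite !inE.
apply: measurable_indic.
have := measurable_fun_ler (measurable_funP (tau i 0%N)) (measurable_s_inv t).
by move=> /(_ measurableT [set true] I); rewrite setTI.
Qed.

(** The atoms increase from a positive first one, so the window is empty exactly when the first atom
    lies beyond [u]. *)
Lemma Y_C_countE (u : R) x : 0 <= u ->
  (forall i B, measurable B -> B `<=` Rplus R ->
     nu i x B = (\sum_(0 <= j <oo) \d_(tau i j x) B)%E) ->
  (forall i, 0 < tau i 0%N x) ->
  (forall i j, tau i j x < tau i j.+1 x) ->
  Y_C tau u x = N%:R^-1 * \sum_i (nu i x `]0%R, u]%classic != 0%E)%:R.
Proof.
move=> u0 nuE tau0 tauS; congr (_ * _); apply: eq_bigr => i _.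
rewrite indicE; congr ((nat_of_bool _)%:R).
have nuBE := nuE i `]0, u]%classic (measurable_itv _).
rewrite nuBE; last by move=> y; rewrite RplusE /= in_itv/= => /andP[/ltW].
apply/idP/idP.
  rewrite inE /= => tu; rewrite gt_eqF//.
  rewrite nneseries_recl//.
  rewrite diracE mem_set/=; last by rewrite in_itv/= tau0.
  by rewrite (@lt_le_trans _ _ 1%E)// leeDl// nneseries_ge0.
apply: contraNT; rewrite notin_setE /= => /negP; rewrite -ltNge => ut.
have tj j : u < tau i j x.
  by elim: j => // j IH; exact: lt_trans IH (tauS i j).
rewrite eseries0// => j _ _; rewrite diracE memNset//= in_itv/=.
by move=> /andP[_]; rewrite leNgt tj.
Qed.

End inverse_of_total.

(** * Laplace transforms of the empirical measures and of their limit *)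

Section laplace_transform.
Context (R : realType).

Lemma integral_empirical_measure (N : nat) (w : 'I_N -> R) (f : R -> R) :
  (forall i, 0 <= w i) -> measurable_fun setT f -> (forall x, 0 <= f x) ->
  \int[empirical_measure w]_(x in Rplus R) f x = N%:R^-1 * \sum_i f (w i).
Proof.
move=> w0 mf f0.
(* [msum] runs over naturals, so [w] is extended by 0; only indices below [N] occur in the sum. *)
pose W k := if insub k is Some i then w i else 0.
pose N1 : {nonneg R} := NngNum (ltac:(by rewrite invr_ge0) : 0 <= N%:R^-1 :> R).
have mRp : measurable (Rplus R) by exact: measurable_itv.
have mfE : measurable_fun (Rplus R) (EFin \o f).
  by apply/measurable_EFinP; exact: measurable_funTS.
have fE0 x : Rplus R x -> (0 <= (EFin \o f) x)%E by rewrite lee_fin.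
rewrite /Rintegral (eq_measure_integral
    (mscale N1 (msum (fun k => \d_(W k)) N))); last first.
  move=> A mA _; rewrite /= /empirical_measure /mscale /msum /=.
  by congr (_ * _)%E; apply: eq_bigr => i _; rewrite /W valK.
rewrite ge0_integral_mscale// ge0_integral_measure_sum//.
have -> : (\sum_(k < N) \int[\d_(W k)]_(x in Rplus R) (f x)%:E =
    (\sum_(i < N) f (w i))%:E)%E.
  rewrite -sumEFin; apply: eq_bigr => i _.
  rewrite /W valK integral_dirac// diracE mem_set ?mul1e//.
  by rewrite RplusE.
by rewrite -EFinM.
Qed.

Variable lambda : probability R R.
Hypothesis lambda_Rplus : lambda (Rplus R) = 1%E.

Let mRp : measurable (Rplus R).
Proof. exact: measurable_itv. Qed.

Lemma measurable_exp_scale (t : R) : measurable_fun setT (fun x : R => expR (- (x * t))).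
Proof.
apply: measurableT_comp => //; apply: measurableT_comp => //.
exact: measurable_funM.
Qed.

Let L (t : R) := \int[lambda]_(x in Rplus R) expR (- (x * t)).

Lemma laplace0 : L 0 = 1.
Proof.
rewrite /L /Rintegral (eq_integral (cst 1%E)); last first.
  by move=> x _; rewrite mulr0 oppr0 expR0.
rewrite integral_cst// mul1e; exact: (congr1 fine lambda_Rplus).
Qed.

Lemma exp_scale_le1 (v x : R) : 0 <= v -> Rplus R x -> `|expR (- (x * v))| <= 1.
Proof.
move=> v0; rewrite RplusE => x0.
by rewrite ger0_norm ?expR_ge0// -expR0 ler_expR oppr_le0 mulr_ge0.
Qed.

(** Dominated convergence with the constant 1 as dominating function. *)
Lemma laplace_continuous (t e : R) : 0 <= t -> 0 < e ->
  exists2 h : R, 0 < h & forall v, 0 <= v -> `|t - v| < h -> `|L t - L v| < e.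
Proof.
move=> t0 e0.
(* [`|v|] extends the integrand to a neighbourhood of [v = 0] on which it is
   still bounded by 1. *)
pose f (v x : R) := expR (- (x * `|v|)).
have fle1 v x : Rplus R x -> `|f v x| <= 1.
  exact: exp_scale_le1.
have int1 : lambda.-integrable (Rplus R) (EFin \o cst 1).
  by apply: finite_measure_integrable_cst.
have cF : {in `]t - 1, t + 1[%classic,
    continuous (fun v => \int[lambda]_(x in Rplus R) f v x)}.
  apply: (@continuity_under_integral _ _ _ lambda f _ mRp _ _ _ _ (cst 1)) => //.
  - move=> v _; apply: le_integrable int1 => //.
      by apply/measurable_EFinP; apply: measurable_funTS; exact: measurable_exp_scale.
    by move=> x Rx; rewrite /= lee_fin normr1; exact: fle1.
  - apply: aeW => x _ v _; apply: continuous_comp; last exact: continuous_expR.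
    apply: continuousN; apply: continuousM; first exact: cst_continuous.
    exact: norm_continuous.
  - by move=> v _; apply: aeW => x; exact: fle1.
have /cF : t \in `]t - 1, t + 1[%classic.
  by rewrite inE /= in_itv/= ltrBlDr !ltrDl ltr01.
move=> /cvgrPdist_lt/(_ e e0)[h h0 H]; exists h => // v v0 tv.
have E u : 0 <= u -> \int[lambda]_(x in Rplus R) f u x = L u.
  by move=> u0; apply: eq_Rintegral => x _; rewrite /f ger0_norm.
by have := H v tv; rewrite !E.
Qed.

(** For [v >= 0] the exponential is continuous and bounded by 1 on R_+, hence an admissible test
    function for weak convergence. *)
Lemma cvg_empirical_laplace (w : forall N : nat, 'I_N -> R) (v : R) :
  (forall N (i : 'I_N), 0 <= w N i) ->
  weakly_cvg_Rplus (fun N => empirical_measure (w N)) lambda -> 0 <= v ->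
  N%:R^-1 * \sum_i expR (- (w N i * v)) @[N --> \oo] --> L v.
Proof.
move=> w0 w_lambda v0.
have := w_lambda (fun x => expR (- (x * v))).
rewrite [X in X @ \oo](_ : _ =
    fun N => N%:R^-1 * \sum_i expR (- (w N i * v))); last first.
  apply/funext => N; rewrite integral_empirical_measure//.
  exact: measurable_exp_scale.
apply; last by exists 1 => x; exact: exp_scale_le1.
apply: continuous_subspaceT => x; apply: continuous_comp.
  by apply: continuousN; apply: continuousM => //; exact: cst_continuous.
exact: continuous_expR.
Qed.

End laplace_transform.

(** * The squeeze for a fixed number of coupons *)

Lemma measurable_norm_ge d (T : measurableType d) (R : realType) (f : T -> R) (b : R) :
  measurable_fun setT f -> measurable [set x | b <= `|f x|].
Proof.
move=> mf; have := measurable_fun_ler (measurable_cst b)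
  (measurableT_comp (@normr_measurable R setT) mf).
by move=> /(_ measurableT [set true] I); rewrite setTI.
Qed.

(** [A] is covered by [B] and a null set. This turns pathwise bounds, available only almost surely,
    into bounds on probabilities. *)
Lemma le_measure_ae d (T : measurableType d) (R : realType)
    (mu : {measure set T -> \bar R}) (A B : set T) :
  measurable A -> measurable B -> {ae mu, forall x, A x -> B x} ->
  (mu A <= mu B)%E.
Proof.
move=> mA mB [C [mC C0 AB]]; rewrite -[leRHS]adde0 -C0.
apply: le_trans (measureU2 _ mB mC); apply: le_measure; rewrite ?inE//.
  exact: measurableU.
move=> x Ax; have [Bx|nBx] := pselect (B x); [by left|right].
by apply: AB => /(_ Ax).
Qed.

Section coupon_collector_law.
Context (R : realType) (d : measure_display) (T : measurableType d).
Variables (P : probability T R) (a : R -> R).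
Hypothesis a_loc : L1loc_Rplus a.
Hypothesis a_gt0 : forall t : R, 0 <= t -> 0 < a t.
Hypothesis a_infty :
  (\int[lebesgue_measure]_(u in Rplus R) (a u)%:E = +oo)%E.

Let a_ge0 (t : R) : 0 <= t -> 0 <= a t.
Proof. by move=> /a_gt0/ltW. Qed.

Section fixed_population.
Variables (N : nat) (w : 'I_N -> R) (rho : 'I_N -> {measure set R -> \bar R}).
Variables (nu : 'I_N -> R.-ker T ~> R) (tau : 'I_N -> nat -> {RV P >-> R}).
Hypothesis w_gt0 : forall i, 0 < w i.
Hypothesis rho_w : forall i (s t : R), 0 <= s -> s <= t ->
  rho i `]s, t]%classic =
    ((w i)%:E * \int[lebesgue_measure]_(u in `]s, t]) (a u)%:E)%E.
Hypothesis nu_poisson : forall i, poisson_random_measure P (rho i) (nu i).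
Hypothesis nu_indep :
  independent_systems P (fun i => sigma_of_random_measure (nu i)).
Hypothesis nu_tau : atomic_decomposition nu tau.
Hypothesis N_gt0 : (0 < N)%N.

Let Z := \sum_(i < N) w i.

Lemma total_weight_gt0 : 0 < Z.
Proof.
rewrite /Z; case: N w w_gt0 N_gt0 => // n u u0 _.
by rewrite big_ord_recl ltr_pwDl// sumr_ge0// => i _; exact/ltW.
Qed.

(* The window whose A-length is [v]: its counts are Poisson with means [w i * v]. *)
Let B (v : R) : set R := `]0, A_inv a v].

Let mB v : measurable (B v).
Proof. exact: measurable_itv. Qed.

Let B_Rplus v : B v `<=` Rplus R.
Proof. by move=> y; rewrite RplusE /B /= in_itv/= => /andP[/ltW]. Qed.

Let nuB v : 0 <= v -> forall i (k : nat),
  P [set x | nu i x (B v) = k%:R%:E] = poisson_prob (w i * v) 0 [set k].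
Proof.
move=> v0 i k; have [+ _ _] := nu_poisson i.
have u0 : 0 <= A_inv a v by exact: A_inv_ge0.
have rhoB : rho i (B v) = (w i * v)%:E.
  by rewrite rho_w// A_int_oc// A_invK.
move=> /(_ (B v) (mB v) (@B_Rplus v)); rewrite rhoB ltry => /(_ isT) -> //.
Qed.

Let measurable_total v b :
  measurable [set x | b <= `|\sum_i fine (nu i x (B v)) - Z * v|].
Proof.
apply: measurable_norm_ge; apply: measurable_funB => //.
by apply: measurable_sum => i; apply: measurableT_comp => //; exact: measurable_kernel.
Qed.

Let measurable_nonempty v b c :
  measurable [set x | b <= `|\sum_i (nu i x (B v) != 0%E)%:R - c| :> R].
Proof.
apply: measurable_norm_ge; apply: measurable_funB => //.
apply: measurable_sum => i.
rewrite (_ : (fun _ => _) =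
  (fun y : \bar R => (y != 0%E)%:R) \o (fun x => nu i x (B v)))//.
apply: measurableT_comp; first exact: measurable_nonzero.
exact: measurable_kernel.
Qed.

(** The factors [Z] and [N] make [h] a shift in A-time and [e] an error in the collected
    fraction. *)
Definition atypical (v h e : R) : set T :=
  [set x | Z * h <= `|\sum_i fine (nu i x (B v)) - Z * v|] `|`
  [set x | N%:R * e <= `|\sum_i (nu i x (B v) != 0%E)%:R
                         - \sum_i (1 - expR (- (w i * v)))|].

Lemma measurable_atypical v h e : measurable (atypical v h e).
Proof.
by apply: measurableU; [exact: measurable_total|exact: measurable_nonempty].
Qed.

(** A union bound over two Chebyshev estimates: variance [Z * v] against [(Z * h) ^+ 2], and
    variance at most [N] against [(N * e) ^+ 2]. *)
Lemma atypical_le v h e : 0 < v -> 0 < h -> 0 < e ->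
  (P (atypical v h e) <= (v / h ^+ 2 / Z + (e ^+ 2)^-1 / N%:R)%:E)%E.
Proof.
move=> v0 h0 e0.
have wv0 i : 0 < w i * v by rewrite mulr_gt0.
have Z0 := total_weight_gt0.
have N0 : 0 < N%:R :> R by rewrite ltr0n.
have Zh0 : 0 < Z * h by rewrite mulr_gt0.
have Ne0 : 0 < N%:R * e by rewrite mulr_gt0.
have H1 := total_count_concentration (mB v) (@B_Rplus v) nu_indep wv0
  (nuB (ltW v0)) Zh0.
have H2 := nonempty_count_concentration (mB v) (@B_Rplus v) nu_indep wv0
  (nuB (ltW v0)) Ne0.
have -> : v / h ^+ 2 / Z = (Z * h) ^- 2 * (Z * v).
  by field; rewrite !gt_eqF.
have -> : (e ^+ 2)^-1 / N%:R = (N%:R * e) ^- 2 * N%:R.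
  by field; rewrite !gt_eqF.
rewrite EFinD; apply: le_trans (leeD H1 H2).
exact: measureU2.
Qed.

Lemma typicalP v h e : 0 < v -> {ae P, forall x, ~ atypical v h e x ->
  [/\ ((Z * (v - h))%:E < S_total nu (A_inv a v) x)%E,
      (S_total nu (A_inv a v) x < (Z * (v + h))%:E)%E &
      `|Y_C tau (A_inv a v) x -
        (1 - N%:R^-1 * \sum_i expR (- (w i * v)))| < e]}.
Proof.
move=> v0.
have wv0 i : 0 < w i * v by rewrite mulr_gt0.
have u0 : 0 <= A_inv a v by apply: A_inv_ge0 => //; exact: ltW.
have fin := count_ae_fin_num (mB v) wv0 (nuB (ltW v0)).
have N0 : 0 < N%:R :> R by rewrite ltr0n.
apply: filterS2 fin nu_tau => x fin [nuE tau0 tauS _].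
move=> /not_orP[/= /negP + /negP]; rewrite -!ltNge => HS HY.
have SE : S_total nu (A_inv a v) x = (\sum_i fine (nu i x (B v)))%:E.
  by rewrite /S_total -sumEFin; apply: eq_bigr => i _; rewrite fineK.
move: HS; rewrite ltr_distl SE !lte_fin mulrBr mulrDr => /andP[-> ->]; split=> //.
rewrite (Y_C_countE u0 nuE tau0 tauS) -(ltr_pM2l N0).
rewrite -[X in X * `|_|]gtr0_norm// -normrM mulrBr mulVKf ?gt_eqF//.
rewrite (_ : N%:R * _ = \sum_i (1 - expR (- (w i * v))))//.
rewrite sumrB sumr_const card_ord mulrBr mulr1 mulVKf// gt_eqF//.
Qed.

(** In the typical case the total has passed [Z * t] by time [A_inv a (t + h)], so [s_inv] is at
    most that time and monotonicity of [Y_C] applies. *)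
Lemma Y_C_s_inv_lt t h e : 0 <= t -> 0 < h ->
  {ae P, forall x, ~ atypical (t + h) h e x ->
    Y_C tau (s_inv nu (Z * t) x) x <
    1 - N%:R^-1 * \sum_i expR (- (w i * (t + h))) + e}.
Proof.
move=> t0 h0; have th0 : 0 < t + h by rewrite ltr_wpDl.
apply: filterS (typicalP h e th0) => x /[apply].
rewrite addrK => -[Zt _ Ye]; apply: le_lt_trans (ltr_distlDr Ye).
by apply/Y_C_mono/s_inv_le => //; apply: A_inv_ge0 => //; exact: ltW.
Qed.

(** Typicality of the window [t - h] keeps the total below [Z * t] up to its end; typicality of
    [t + h] ensures that the level is passed at all, as [s_inv_ge] demands. *)
Lemma Y_C_s_inv_gt t h e : 0 < h -> h < t ->
  {ae P, forall x, ~ atypical (t + h) h e x -> ~ atypical (t - h) h e x ->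
    1 - N%:R^-1 * \sum_i expR (- (w i * (t - h))) - e <
    Y_C tau (s_inv nu (Z * t) x) x}.
Proof.
move=> h0 ht; have mh0 : 0 < t - h by rewrite subr_gt0.
have th0 : 0 < t + h by rewrite ltr_wpDl// (le_trans (ltW h0))// ltW.
apply: filterS2 (typicalP h e th0) (typicalP h e mh0) => x H1 H2 n1 n2.
have [+ _ _] := H1 n1; have [_ + Ye] := H2 n2.
rewrite addrK subrK => tZ Zt; apply: lt_le_trans (ltr_distlCBl Ye) _.
apply: Y_C_mono; apply: (s_inv_ge (u' := A_inv a (t + h))) => //.
  by apply: A_inv_ge0 => //; exact: ltW.
exact: ltW.
Qed.

End fixed_population.
End coupon_collector_law.

(** * Passage to the limit in the number of coupons *)

Theorem theorem5p3 (R : realType) (d : measure_display) (T : measurableType d)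
    (P : probability T R)
    (a : R -> R)
    (w : forall N : nat, 'I_N -> R)
    (rho : forall N : nat, 'I_N -> {measure set R -> \bar R})
    (nu : forall N : nat, 'I_N -> R.-ker T ~> R)
    (tau : forall N : nat, 'I_N -> nat -> {RV P >-> R})
    (lambda : probability R R)
    (a_loc : L1loc_Rplus a)
    (a_gt0 : forall t : R, 0 <= t -> 0 < a t)
    (a_infty : (\int[lebesgue_measure]_(u in Rplus R) (a u)%:E = +oo)%E)
    (w_gt0 : forall N (i : 'I_N), 0 < w N i)
    (rho_w : forall N (i : 'I_N) (s t : R), 0 <= s -> s <= t ->
      rho N i `]s, t]%classic =
        ((w N i)%:E * \int[lebesgue_measure]_(u in `]s, t]) (a u)%:E)%E)
    (nu_poisson : forall N (i : 'I_N),
      poisson_random_measure P (rho N i) (nu N i))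
    (nu_indep : forall N, independent_systems P
      (fun i : 'I_N => sigma_of_random_measure (nu N i)))
    (nu_tau : forall N, atomic_decomposition (nu N) (tau N))
    (Z_infty : \sum_(i < N) w N i @[N --> \oo] --> +oo)
    (lambda_Rplus : lambda (Rplus R) = 1%E)
    (w_lambda : weakly_cvg_Rplus (fun N => empirical_measure (w N)) lambda) :
  forall t : R, 0 <= t ->
    y_C a lambda (A_inv a t) =
      1 - \int[lambda]_(x in Rplus R) expR (- (x * t)) /\
    cvg_in_probability P
      (fun N x =>
         Y_C (tau N) (s_inv (nu N) ((\sum_(i < N) w N i) * t) x) x)
      (y_C a lambda (A_inv a t)).
Proof.
move=> t t0.
have a_ge0 (u : R) : 0 <= u -> 0 <= a u by move=> /a_gt0/ltW.
pose L (v : R) := \int[lambda]_(x in Rplus R) expR (- (x * v)).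
pose LN N (v : R) := N%:R^-1 * \sum_i expR (- (w N i * v)).
pose Z N := \sum_(i < N) w N i.
have yE : y_C a lambda (A_inv a t) = 1 - L t by rewrite /y_C A_invK.
split; first exact: yE.
rewrite yE => e e0.
(* One third pays for moving [t] by [h] in [L], one for replacing [L] by [LN N], one for the random
   error of the collected fraction. *)
have e30 : 0 < e / 3 by rewrite divr_gt0.
have LN_cvg (v : R) : 0 <= v -> LN N v @[N --> \oo] --> L v.
  by move=> v0; apply: cvg_empirical_laplace => // N i; exact: ltW.
have LN_near (v : R) : 0 <= v -> `|L t - L v| < e / 3 ->
    \forall N \near \oo, `|L t - LN N v| < e / 3 + e / 3.
  move=> v0 tv; have /cvgrPdist_lt/(_ _ e30) := LN_cvg v v0.
  apply: filterS => N vN; rewrite -(subrK (L v) (L t)) -addrA.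
  by rewrite (le_lt_trans (ler_normD _ _))// ltrD.
have [h' h'0 Lh] := laplace_continuous lambda t0 e30.
(* [h] stays within the continuity modulus [h'] and, when [t] is positive, below [t], so that the
   window [t - h] has positive length. *)
have [h [h0 hh' ht]] : exists h, [/\ 0 < h, h < h' & 0 < t -> h < t].
  have [t_gt0|t_le0] := ltP 0 t; last first.
    exists (h' / 2); split; rewrite ?divr_gt0//.
    by rewrite ltr_pdivrMr// ltr_pMr// ltr1n.
  exists (Num.min h' t / 2); split.
  - by rewrite divr_gt0// lt_min h'0.
  - by rewrite ltr_pdivrMr// gt_min ltr_pMr// ltr1n.
  - by move=> _; rewrite ltr_pdivrMr// gt_min (ltr_pMr _ t_gt0) ltr1n orbT.
pose c (v : R) N := v / h ^+ 2 / Z N + ((e / 3) ^+ 2)^-1 / N%:R.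
pose F v N := atypical a (w N) (nu N) v h (e / 3).
(* At [t = 0] there is no lower window, and the corresponding bad event is taken empty. *)
pose G N := if 0 < t then F (t - h) N else set0.
have mG N : measurable (G N).
  by rewrite /G; case: ifPn => // _; exact: measurable_atypical.
have c_cvg v : c v N @[N --> \oo] --> 0.
  have N_pos : \forall N \near \oo, 0 < N%:R :> R.
    by near=> N; rewrite ltr0n; near: N; exact: nbhs_infty_gt.
  have Z_pos : \forall N \near \oo, 0 < Z N.
    near=> N; apply: total_weight_gt0 => //; near: N; exact: nbhs_infty_gt.
  rewrite -[X in _ --> X]addr0; apply: cvgD.
    rewrite -(mulr0 (v / h ^+ 2)); apply: cvgMr.
    exact: (gtr0_cvgV0 Z_pos).2 Z_infty.
  rewrite -(mulr0 ((e / 3) ^+ 2)^-1); apply: cvgMr.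
  exact: (gtr0_cvgV0 N_pos).2 (@cvgr_idn R).
(* For [t > 0] the norm in [t - h] changes nothing; at [t = 0] it keeps the second summand
   nonnegative, which is enough to bound the probability of the empty set. *)
have bound : \forall N \near \oo,
    (P [set x | e < `|Y_C (tau N) (s_inv (nu N) (Z N * t) x) x - (1 - L t)|]%R <=
     (c (t + h) N + c `|t - h| N)%:E)%E.
  have th0 : 0 < t + h by rewrite ltr_wpDl.
  have up_near := LN_near (t + h) (ltW th0).
  have down_near : \forall N \near \oo,
      0 < t -> `|L t - LN N (t - h)| < e / 3 + e / 3.
    have [t_gt0|_] := ltP 0 t; last exact: nearW.
    have th : 0 <= t - h by rewrite subr_ge0 ltW// ht.
    apply: filterS (LN_near _ th _) => //; apply: Lh => //.
    by rewrite subKr gtr0_norm.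
  have {}up_near : \forall N \near \oo, `|L t - LN N (t + h)| < e / 3 + e / 3.
    apply: up_near; apply: Lh; first exact: ltW.
    by rewrite opprD addNKr normrN gtr0_norm.
  near=> N; have N0 : (0 < N)%N by near: N; exact: nbhs_infty_gt.
  have upN : `|L t - LN N (t + h)| < e / 3 + e / 3 by near: N.
  have downN : 0 < t -> `|L t - LN N (t - h)| < e / 3 + e / 3 by near: N.
  have cF v : 0 < v -> (P (F v N) <= (c v N)%:E)%E.
    by move=> v0; apply: (atypical_le a_loc a_gt0 a_infty (@w_gt0 N) (@rho_w N)
      (@nu_poisson N)).
  have cG : (P (G N) <= (c `|t - h| N)%:E)%E.
    rewrite /G; case: ifPn => [t_gt0|_]; last first.
      rewrite measure0 lee_fin /c addr_ge0//.
        by rewrite !divr_ge0// ?sqr_ge0// sumr_ge0// => i _; exact: ltW.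
      by rewrite divr_ge0// invr_ge0 sqr_ge0.
    have th : 0 < t - h by rewrite subr_gt0 ht.
    by rewrite gtr0_norm// cF.
  have mF : measurable (F (t + h) N) by exact: measurable_atypical.
  rewrite EFinD; apply: le_trans (leeD (cF _ th0) cG).
  apply: le_trans (measureU2 _ mF (mG N)).
  apply: le_measure_ae; [|exact: measurableU|].
    have mY := measurable_Y_C_s_inv (nu N) (tau N) (Z N * t).
    have := measurable_fun_ltr (measurable_cst e) (measurableT_comp
      (@normr_measurable R setT) (measurable_funB mY (measurable_cst (1 - L t)))).
    by move=> /(_ measurableT [set true] I); rewrite setTI.
  have up := Y_C_s_inv_lt a_loc a_gt0 a_infty (@w_gt0 N) (@rho_w N)
    (@nu_poisson N) (@nu_tau N) N0 (e / 3) t0 h0.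
  have down : {ae P, forall x, ~ F (t + h) N x -> ~ G N x ->
      1 - L t - e < Y_C (tau N) (s_inv (nu N) (Z N * t) x) x}.
    rewrite /G; have [t_gt0|t_le0] := ltP 0 t.
      have := Y_C_s_inv_gt a_loc a_gt0 a_infty (@w_gt0 N) (@rho_w N)
        (@nu_poisson N) (@nu_tau N) N0 (e / 3) h0 (ht t_gt0).
      apply: filterS => x H nF nG; apply: le_lt_trans (H nF nG).
      move: (downN t_gt0); rewrite ltr_distl /LN => /andP[H1 H2]; lra.
    (* At [t = 0] the limit [1 - L 0] is 0, so the lower bound is [- e], which lies below any
       collected fraction. *)
    apply: aeW => x _ _; apply: lt_le_trans (Y_C_ge0 _ _ _).
    have -> : t = 0 by apply/eqP; rewrite eq_le t_le0.
    by rewrite /L laplace0// subrr sub0r oppr_lt0.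
  apply: filterS2 up down => x Hup Hdown /=; apply: contraPP => /not_orP[nF nG].
  apply/negP; rewrite -leNgt ltW// ltr_distl Hdown//=.
  apply: (lt_trans (Hup nF)); move: upN; rewrite ltr_distl /LN => /andP[H1 H2]; lra.
apply: (@squeeze_cvge _ _ _ _ (cst 0%E) _
  (fun N => (c (t + h) N + c `|t - h| N)%:E)).
- by apply: filterS bound => N ->; rewrite andbT; exact: measure_ge0.
- exact: cvg_cst.
- by apply: cvg_EFin; [exact: nearW|rewrite -[X in _ --> X]addr0; exact: cvgD].
Unshelve. all: by end_near. Qed.
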